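(* Let $G=(V,E)$ be a connected graph with countable vertex set $V$, equipped with a positive weight $\mu:V\to\mathbb{R}$, and let $M\ge 1$ be an integer such that every vertex of $G$ has degree at most $M$. Suppose that there exist a rooted spanning tree $(V,E_T)$ of $G$ and a constant $c>0$ such that $$\mu(S_t)\le c\,\mu(t)\quad\text{for all } t\in V,$$ where $S_t=\{s\in V: s\succeq t\}$ is the shadow of $t$ with respect to this rooted spanning tree. Let $p\in[1,\infty)$. Then there exists a constant $C_P>0$ such that $$\|f\|_{\ell^p(V,\mu)}\le C_P\,\big\||\nabla f|\big\|_{\ell^p(V,\mu)}$$ holds for every $f\in\ell^p(V,\mu)$ with $\sum_{s\in V}f(s)\mu(s)=0$. Furthermore, the constant can be taken to satisfy $$C_P\le 2c\,(Mp)^{1-1/p}.$$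
   Context: Graphs are undirected; $x\sim y$ means $(x,y)\in E$. A spanning tree $(V,E_T)$ of $G$ is a connected acyclic subgraph with $E_T\subseteq E$ containing all vertices; it is rooted if a vertex $a\in V$ (the root) is distinguished. The rooted spanning tree induces a partial order on $V$: $s\succeq t$ if the unique path in the tree from $s$ to the root $a$ contains $t$. For $A\subseteq V$, $\mu(A)=\sum_{s\in A}\mu(s)$. (The hypothesis $\mu(S_t)\le c\mu(t)$, applied to $t=a$, includes $\mu(V)<\infty$.) $\ell^p(V,\mu)$ is the space of $f:V\to\mathbb{R}$ with $\|f\|_{\ell^p(V,\mu)}=\left(\sum_{s\in V}|f(s)|^p\mu(s)\right)^{1/p}<\infty$. The length of the gradient of $f:V\to\mathbb{R}$ is the function $|\nabla f|:V\to\mathbb{R}_{\ge0}$, $$|\nabla f|(t)=\sum_{s:\,s\sim t}|f(s)-f(t)|,$$ the sum being over all neighbors of $t$ in the graph $G$. If $|\nabla f|\notin\ell^p(V,\mu)$, the right-hand side of the inequality is understood as $+\infty$. *)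

(* Defs.v *)
From mathcomp Require Import all_boot all_order all_algebra.
From mathcomp Require Import all_classical all_reals.
From mathcomp Require Import ereal esum numfun exp.
Set Implicit Arguments.
Unset Strict Implicit.
Unset Printing Implicit Defensive.
Import Order.TTheory GRing.Theory Num.Theory.

Local Open Scope classical_set_scope.
Local Open Scope ring_scope.

Section Graphs.
Variable V : countType.
Implicit Types (e eT : rel V) (a s t : V).

Definition graph_connected e :=
  forall x y : V, exists2 p : seq V, path e x p & last x p = y.

(* For a symmetric relation, [:: x; y] is a ucycle as soon as x and y are
   adjacent, so only the ucycles of size at least 3 are cycles of the graph;
   loops are excluded separately. *)
Definition graph_acyclic e :=
  irreflexive e /\ forall c : seq V, ucycle e c -> (size c <= 2)%N.

Definition spanning_tree e eT :=
  [/\ symmetric eT, subrel eT e, graph_connected eT & graph_acyclic eT].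

Definition neighbors e t : set V := [set s | e s t].

Definition degree_le e (M : nat) := forall t, (neighbors e t #<= `I_M)%card.

(* s >= t: the path without repetition from s to the root a contains t. *)
Definition tree_ge eT a s t :=
  exists p : seq V,
    [/\ path eT s p, uniq (s :: p), last s p = a & t \in s :: p].

Definition shadow eT a t : set V := [set s | tree_ge eT a s t].

End Graphs.

Section Weighted.
Variables (R : realType) (V : countType).
Implicit Types (mu f : V -> R) (e : rel V).

Definition weight mu (A : set V) : \bar R := \esum_(s in A) (mu s)%:E.

(* The finitely supported sum is the full sum over the neighbors of t, since
   it is only used for graphs whose vertices have finite degree. *)
Definition gradient e f (t : V) : R :=
  \sum_(s \in neighbors e t) `|f s - f t|.

Definition lpnorm mu (p : R) f : \bar R :=
  ((\esum_(s in [set: V]) (`|f s| `^ p * mu s)%:E) `^ p^-1)%E.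

Definition in_lp mu (p : R) f := (lpnorm mu p f < +oo)%E.

(* \esum is meant for nonnegative terms only, so the sum of f * mu is taken as
   the difference of the sums of its positive and negative parts. *)
Definition weighted_sum mu f : \bar R :=
  let g := fun s => (f s * mu s)%:E in
  (\esum_(s in [set: V]) g^\+ s - \esum_(s in [set: V]) g^\- s)%E.

End Weighted.

(* Main.v *)
(** Put [g = f - f a], [G = \sum |g|^p mu], [F = \sum |f|^p mu] and
    [D = \sum |grad f|^p mu].  Telescoping [|g|^p] along the tree path from [s]
    to the root, with [x^p - y^p <= p x^(p-1) (x - y)] at each edge, bounds
    [|g s|^p] by the sum of [p |g|^(p-1) |grad f|] over the ancestors of [s].
    Summing over [s] and exchanging the sums brings in [mu (S_t) <= c mu t], and
    Young's inequality then gives [G <= (c p)^p D].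

    As [f] has mean zero, Jensen's inequality gives [F <= 2^p G], and for
    [p <= 2] the Clarkson inequality improves this to [F <= 2 G].  With
    [p <= 2^(p-1)] for [p >= 2] and [p <= 4^(p-1)] for [p <= 2], this is the
    claimed constant as soon as [M >= 2].  If [M = 1], every vertex is the root
    or adjacent to it, so [|g| <= |grad f|] pointwise and [c >= 1] suffices. *)

Require Import Defs.
From mathcomp Require Import all_boot all_order all_algebra.
From mathcomp Require Import all_classical all_reals.
From mathcomp Require Import ereal esum numfun sequences exp.
From mathcomp Require Import lra ring.
Import Order.TTheory GRing.Theory Num.Theory.
Local Open Scope classical_set_scope.
Local Open Scope ring_scope.

(** * Scalar inequalities for real powers *)

Section PowerInequalities.
Variable R : realType.
Implicit Types (p q x y k : R).

(** This is convexity of x^p: the tangent line at y lies below the graph. For positive x and y,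
    writing x = y e^L reduces it to 1 + p (e^L - 1) <= e^(p L), which follows from 1 + u <= e^u at u
    = (p-1) L and at u = -L. *)
Lemma powR_tangent p x y : 1 <= p -> 0 <= x -> 0 <= y ->
  y `^ p + p * y `^ (p - 1) * (x - y) <= x `^ p.
Proof.
move=> p1 x0 y0.
have p0 : 0 < p by lra.
move: (mulr_powRB1 y0 p0) => yE; rewrite -yE.
have [xy|] := eqVneq (x * y) 0; last first.
  rewrite mulf_eq0 negb_or => /andP[xN0 yN0].
  have {}x0 : 0 < x by rewrite lt_def xN0.
  have {}y0 : 0 < y by rewrite lt_def yN0.
  have [L xE] : exists L, x = y * expR L.
    exists (ln x - ln y); rewrite expRD expRN !lnK ?posrE//.
    by field.
  rewrite xE powRM ?expR_ge0 ?(ltW y0)// -yE.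
  have -> : expR L `^ p = expR L * expR ((p - 1) * L).
    by rewrite /powR gt_eqF ?expR_gt0// expRK -expRD; congr expR; ring.
  have H1 := expR_ge1Dx ((p - 1) * L).
  have H2 := expR_ge1Dx (- L).
  have H3 : expR L * expR (- L) = 1 by rewrite -expRD subrr expR0.
  have H4 : expR L * p <=
      expR L * (expR ((p - 1) * L) + (p - 1) * expR (- L)).
    rewrite ler_pM2l ?expR_gt0//.
    have : 0 <= (p - 1) * (expR (- L) - 1 + L) by apply: mulr_ge0; lra.
    lra.
  have := powR_ge0 y (p - 1) => w0.
  rewrite -subr_ge0.
  have -> : y * y `^ (p - 1) * (expR L * expR ((p - 1) * L)) -
     (y * y `^ (p - 1) + p * y `^ (p - 1) * (y * expR L - y)) =
     (y * y `^ (p - 1)) *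
       (expR L * expR ((p - 1) * L) - (1 + p * (expR L - 1))) by ring.
  apply: mulr_ge0; first exact: mulr_ge0 (ltW y0) w0.
  move: H4; rewrite mulrDr mulrCA H3 mulr1; lra.
move: xy => /eqP; rewrite mulf_eq0 => /orP[]/eqP->.
  have : 0 <= y * y `^ (p - 1) by rewrite mulr_ge0 ?powR_ge0.
  rewrite powR0 ?gt_eqF// => h; have := mulr_ge0 (_ : 0 <= p - 1) h; lra.
(* Here y = 0, and 0^(p-1) is 1 if p = 1 and 0 otherwise. *)
have [p_eq1|pN1] := eqVneq p 1; first by rewrite p_eq1 subrr powRr0 powRr1//; lra.
by rewrite (@powR0 _ (p - 1)) ?subr_eq0// mul0r mulr0 mul0r addr0 powR_ge0.
Qed.

(** Add the tangent inequalities at the midpoint: the linear terms cancel. *)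
Lemma powR_midpoint p x y : 1 <= p -> 0 <= x -> 0 <= y ->
  2 * ((x + y) / 2) `^ p <= x `^ p + y `^ p.
Proof.
move=> p1 x0 y0; have m0 : 0 <= (x + y) / 2 by lra.
have := powR_tangent _ _ _ p1 x0 m0; have := powR_tangent _ _ _ p1 y0 m0.
set u := _ `^ (p - 1); set v := _ `^ p; lra.
Qed.

Lemma powR_superadditive p x y : 1 <= p -> 0 <= x -> 0 <= y ->
  x `^ p + y `^ p <= (x + y) `^ p.
Proof.
move=> p1 x0 y0; have p0 : 0 < p by lra.
rewrite -(mulr_powRB1 x0)// -(mulr_powRB1 y0)// -(mulr_powRB1 (addr_ge0 x0 y0))//.
rewrite mulrDl.
by apply: lerD; apply: ler_wpM2l => //; apply: ge0_ler_powR;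
  rewrite ?nnegrE ?subr_ge0 ?addr_ge0 ?lerDl ?lerDr//.
Qed.

Lemma norm_powRD p x y : 1 <= p ->
  `|x + y| `^ p <= 2 `^ (p - 1) * (`|x| `^ p + `|y| `^ p).
Proof.
move=> p1; have p0 : 0 < p by lra.
apply: (@le_trans _ _ ((`|x| + `|y|) `^ p)).
  by apply: ge0_ler_powR; rewrite ?nnegrE ?addr_ge0 ?ler_normD//; lra.
have := powR_midpoint _ _ _ p1 (normr_ge0 x) (normr_ge0 y).
have : 0 <= (`|x| + `|y|) / 2 by rewrite divr_ge0 ?addr_ge0.
set m := (_ / 2); have -> : `|x| + `|y| = 2 * m by rewrite /m; field.
move=> m0 H.
rewrite powRM// -(@mulr_powRB1 _ 2 p)// (mulrC 2) -mulrA.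
by rewrite ler_pM2l ?powR_gt0.
Qed.

(** Midpoint convexity with exponent 1/q, applied to x^q and y^q. The next lemma derives
    subadditivity from superadditivity in the same way. *)
Lemma powR_concave_midpoint q x y : 0 < q <= 1 -> 0 <= x -> 0 <= y ->
  x `^ q + y `^ q <= 2 * ((x + y) / 2) `^ q.
Proof.
move=> /andP[q0 q1] x0 y0.
have iq1 : 1 <= q^-1 by rewrite invf_ge1.
have := powR_midpoint _ _ _ iq1 (powR_ge0 x q) (powR_ge0 y q).
rewrite -!powRrM divff ?gt_eqF// !powRr1// => H.
have {}H : ((x `^ q + y `^ q) / 2) `^ q^-1 <= (x + y) / 2 by lra.
have m0 : 0 <= (x `^ q + y `^ q) / 2 by rewrite divr_ge0 ?addr_ge0 ?powR_ge0.
have : (((x `^ q + y `^ q) / 2) `^ q^-1) `^ q <= ((x + y) / 2) `^ q.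
  by apply: ge0_ler_powR; rewrite ?nnegrE ?powR_ge0 ?(ltW q0)//; lra.
rewrite -powRrM mulVf ?gt_eqF// powRr1//; lra.
Qed.

Lemma powR_subadditive q x y : 0 < q <= 1 -> 0 <= x -> 0 <= y ->
  (x + y) `^ q <= x `^ q + y `^ q.
Proof.
move=> /andP[q0 q1] x0 y0.
have iq1 : 1 <= q^-1 by rewrite invf_ge1.
have := powR_superadditive _ _ _ iq1 (powR_ge0 x q) (powR_ge0 y q).
rewrite -!powRrM divff ?gt_eqF// !powRr1// => H.
have s0 : 0 <= x `^ q + y `^ q by rewrite addr_ge0 ?powR_ge0.
have : (x + y) `^ q <= ((x `^ q + y `^ q) `^ q^-1) `^ q.
  by apply: ge0_ler_powR; rewrite ?nnegrE ?powR_ge0 ?(ltW q0)//; lra.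
by rewrite -powRrM mulVf ?gt_eqF// powRr1.
Qed.

(** With q = p/2 <= 1 and |z|^p = (z^2)^q, concavity bounds the left side through the mean of the
    two squares. That mean is x^2 + y^2 by the parallelogram law, and subadditivity of the q-th
    power concludes. *)
Lemma clarkson_le2 p x y : 1 <= p <= 2 ->
  `|x + y| `^ p + `|x - y| `^ p <= 2 * (`|x| `^ p + `|y| `^ p).
Proof.
move=> /andP[p1 p2].
have q01 : 0 < p / 2 <= 1 by apply/andP; split; lra.
have normE z : `|z| `^ p = (z ^+ 2) `^ (p / 2).
  rewrite -(real_normK (num_real z)).
  rewrite -powR_mulrn// -powRrM mulrCA divff ?mulr1// pnatr_eq0.
rewrite !normE; apply: le_trans (powR_concave_midpoint _ _ _ q01 _ _) _;
  rewrite ?sqr_ge0//.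
rewrite ler_pM2l//.
have -> : ((x + y) ^+ 2 + (x - y) ^+ 2) / 2 = x ^+ 2 + y ^+ 2 by field.
by apply: powR_subadditive; rewrite ?sqr_ge0.
Qed.

Lemma le_powR2 p : 2 <= p -> p <= 2 `^ (p - 1).
Proof.
move=> p2; have p11 : 1 <= p - 1 by lra.
(* The tangent to x^(p-1) at 1, evaluated at 2, is exactly p. *)
have := @powR_tangent (p - 1) 2 1 p11.
rewrite !powR1; lra.
Qed.

Lemma le_powR4 p : 1 <= p -> p <= 4 `^ (p - 1).
Proof.
(* The bound ln 4 >= 1 suffices, since 4^(p-1) >= 1 + (p-1) ln 4. *)
move=> p1; have l2 : 2^-1 <= ln (2 : R).
  have := @le_ln1Dx R (- 2^-1).
  have -> : 1 - 2^-1 = 2^-1 :> R by field.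
  rewrite lnV ?posrE//; lra.
have l4 : 1 <= ln (4 : R).
  have -> : 4 = 2 * 2 :> R by ring.
  rewrite lnM ?posrE//; lra.
rewrite /powR gt_eqF//.
have := expR_ge1Dx ((p - 1) * ln 4).
have : 0 <= (p - 1) * (ln 4 - 1) by apply: mulr_ge0; lra.
lra.
Qed.

End PowerInequalities.

(** * Scaling and exchange of nonnegative sums *)

Lemma ge0_esumZl (R : realType) (T : choiceType) (A : set T) (k : R)
    (a : T -> \bar R) :
  0 <= k -> (forall i, 0 <= a i)%E ->
  (\esum_(i in A) (k%:E * a i) = k%:E * \esum_(i in A) a i)%E.
Proof.
move=> k0 a0; rewrite /esum -ereal_supZl//; last first.
  by apply/set0P; exists 0%E; exists set0; [exact: fsets_set0|rewrite fsbig_set0].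
congr ereal_sup; apply/seteqP; split=> [_ [X fX <-]|_ [_ [X fX <-] <-]].
  by exists (\sum_(i \in X) a i)%E; [exists X|rewrite ge0_mule_fsumr].
by exists X => //; rewrite ge0_mule_fsumr.
Qed.

Lemma esum_swap (R : realType) (S T : choiceType) (P : S -> T -> Prop)
    (a : S -> T -> \bar R) : (forall s t, 0 <= a s t)%E ->
  (\esum_(s in [set: S]) \esum_(t in [set t | P s t]) a s t =
   \esum_(t in [set: T]) \esum_(s in [set s | P s t]) a s t)%E.
Proof.
move=> a0; rewrite (esum_esum (J := fun s => [set t | P s t]))//.
rewrite (esum_esum (J := fun t => [set s | P s t]) (a := fun t s => a s t))//.
rewrite (reindex_esum (setT `*`` (fun t => [set s | P s t])) _
  (fun x => (x.2, x.1)))//.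
split=> [[t s] []//|[t s] [t' s'] _ _ [-> ->]//|[s t] [_ /= Pst]].
by exists (t, s).
Qed.

(** * Weighted sums and functions of mean zero *)

Section WeightedSums.
Variables (R : realType) (V : countType) (mu : V -> R).
Hypothesis mu_gt0 : forall t, 0 < mu t.
Implicit Types (h f : V -> R) (p k : R).

Definition wsum h : \bar R := \esum_(s in [set: V]) (h s * mu s)%:E.

Lemma wsum_ge0 h : (forall s, 0 <= h s) -> (0 <= wsum h)%E.
Proof.
by move=> h0; apply: esum_ge0 => s _; rewrite lee_fin mulr_ge0 ?(ltW (mu_gt0 _)).
Qed.

Lemma le_wsum h h' : (forall s, h s <= h' s) -> (wsum h <= wsum h')%E.
Proof.
by move=> hh'; apply: le_esum => s _; rewrite lee_fin ler_wpM2r ?(ltW (mu_gt0 _)).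
Qed.

Lemma wsumD h h' : (forall s, 0 <= h s) -> (forall s, 0 <= h' s) ->
  wsum (fun s => h s + h' s) = (wsum h + wsum h')%E.
Proof.
move=> h0 h'0; rewrite /wsum -esumD.
- by apply: eq_esum => s _; rewrite mulrDl EFinD.
- by move=> s _; rewrite lee_fin mulr_ge0 ?(ltW (mu_gt0 _)).
- by move=> s _; rewrite lee_fin mulr_ge0 ?(ltW (mu_gt0 _)).
Qed.

Lemma wsumZ k h : 0 <= k -> (forall s, 0 <= h s) ->
  wsum (fun s => k * h s) = (k%:E * wsum h)%E.
Proof.
move=> k0 h0; rewrite /wsum -ge0_esumZl//.
- by apply: eq_esum => s _; rewrite -mulrA EFinM.
- by move=> s; rewrite lee_fin mulr_ge0 ?(ltW (mu_gt0 _)).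
Qed.

Lemma wsum_cst k : 0 <= k -> wsum (fun=> k) = (k%:E * weight mu [set: V])%E.
Proof.
move=> k0; have := wsumZ k (fun=> 1) k0 (fun=> ler01).
rewrite mulr1 => ->; congr (_ * _)%E.
by apply: eq_esum => s _; rewrite mul1r.
Qed.

Lemma weighted_sum0P f : weighted_sum mu f = 0%E ->
  exists2 A : R,
    wsum (fun s => Num.max (f s) 0) = A%:E & wsum (fun s => Num.max (- f s) 0) = A%:E.
Proof.
rewrite /weighted_sum.
set P := esum _ _; set N := esum _ _.
have PE : P = wsum (fun s => Num.max (f s) 0).
  apply: eq_esum => s _.
  by rewrite funeposE -EFin_max maxr_pMl ?(ltW (mu_gt0 _))// mul0r.
have NE : N = wsum (fun s => Num.max (- f s) 0).
  apply: eq_esum => s _.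
  by rewrite funenegE -EFinN -EFin_max maxr_pMl ?(ltW (mu_gt0 _))// mul0r mulNr.
have : (0 <= P)%E by rewrite PE wsum_ge0// => s; rewrite le_max lexx orbT.
have : (0 <= N)%E by rewrite NE wsum_ge0// => s; rewrite le_max lexx orbT.
(* An infinite part would make the difference infinite, even when both are, because +oo - +oo is
   -oo. *)
rewrite -PE -NE; case: P {PE} => [x| |]//; case: N {NE} => [y| |]//= _ _.
move=> [] /eqP; rewrite subr_eq0 => /eqP ->; by exists y.
Qed.

(** Jensen's inequality for f - k, whose mean is -k: integrate the tangent inequality for the p-th
    power at |k|, of slope [w], and use |f - k| - |k| >= -f if k >= 0, or >= f if k < 0. *)
Lemma mean_le_lp p f k : 1 <= p -> weighted_sum mu f = 0%E ->
  ((`|k| `^ p)%:E * weight mu [set: V] <= wsum (fun s => (`|f s - k| `^ p)%R))%E.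
Proof.
move=> p1 /weighted_sum0P[A fp fn].
rewrite -wsum_cst ?powR_ge0//.
pose w := p * `|k| `^ (p - 1).
have w0 : 0 <= w by rewrite mulr_ge0 ?powR_ge0//; lra.
have max0 z : 0 <= Num.max z 0 :> R by rewrite le_max lexx orbT.
have maxB z : Num.max z 0 - Num.max (- z) 0 = z :> R.
  by rewrite !maxEle; case: ifPn; case: ifPn; lra.
have tangent s : `|k| `^ p + w * (`|f s - k| - `|k|) <= `|f s - k| `^ p.
  exact: powR_tangent.
have wA h : (forall s, 0 <= h s) -> wsum h = A%:E ->
    wsum (fun s => w * h s) = (w * A)%:E by move=> h0 hA; rewrite wsumZ// hA.
(* The linear term is split into the positive and negative parts of f, one on each side, so that all
   summands are nonnegative. Both parts sum to the finite [A] and cancel. *)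
suff [h [h' [h0 h'0 hA h'A hh']]] : exists h h' : V -> R,
    [/\ forall s, 0 <= h s, forall s, 0 <= h' s, wsum h = A%:E, wsum h' = A%:E &
        forall s, `|k| `^ p + w * h s <= `|f s - k| `^ p + w * h' s].
  have := le_wsum _ _ hh'.
  rewrite !wsumD; do ?by move=> s; rewrite ?powR_ge0//; exact: mulr_ge0.
  by rewrite (wA h)// (wA h')// leeD2rE.
have [k0|k0] := leP 0 k.
- exists (fun s => Num.max (- f s) 0), (fun s => Num.max (f s) 0).
  split=> // s; apply: le_trans (_ : _ <= `|k| `^ p + w * (`|f s - k| - `|k|) + w * Num.max (f s) 0) _; last by rewrite lerD2r.
  rewrite -addrA lerD2l -mulrDr ler_wpM2l//.
  have := maxB (f s); have := ler_norm (- (f s - k)); rewrite normrN (ger0_norm k0); lra.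
- exists (fun s => Num.max (f s) 0), (fun s => Num.max (- f s) 0).
  split=> // s; apply: le_trans (_ : _ <= `|k| `^ p + w * (`|f s - k| - `|k|) + w * Num.max (- f s) 0) _; last by rewrite lerD2r.
  rewrite -addrA lerD2l -mulrDr ler_wpM2l//.
  have := maxB (f s); have := ler_norm (f s - k); rewrite (ltr0_norm k0); lra.
Qed.

Lemma wsum_shift_fin p f k : 1 <= p -> weight mu [set: V] \is a fin_num ->
  wsum (fun s => `|f s| `^ p) \is a fin_num ->
  wsum (fun s => `|f s - k| `^ p) \is a fin_num.
Proof.
move=> p1 mufin ffin.
rewrite ge0_fin_numE; last by apply: wsum_ge0 => s; exact: powR_ge0.
apply: le_lt_trans (le_wsum _ _ (fun s => norm_powRD _ p (f s) (- k) p1)) _.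
rewrite wsumZ ?powR_ge0//; do ?by move=> s; rewrite addr_ge0 ?powR_ge0.
rewrite wsumD; do ?by move=> s; exact: powR_ge0.
rewrite wsum_cst ?powR_ge0// -ge0_fin_numE ?fin_numM ?fin_numD ?ffin ?fin_numM//.
apply: mule_ge0; first by rewrite lee_fin powR_ge0.
apply: adde_ge0; first by apply: wsum_ge0 => s; exact: powR_ge0.
by apply: mule_ge0; rewrite ?lee_fin ?powR_ge0//; apply: esum_ge0 => s _; rewrite lee_fin ltW.
Qed.

(** Splitting f as (f - k) + k costs 2^(p-1), and by [mean_le_lp] the constant k contributes no more
    than f - k does, whence the second factor 2. *)
Lemma wsum_lp_le_shift p f k : 1 <= p -> weighted_sum mu f = 0%E ->
  (wsum (fun s => (`|f s| `^ p)%R) <= (2 `^ p)%:E * wsum (fun s => (`|f s - k| `^ p)%R))%E.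
Proof.
move=> p1 f0.
apply: (@le_trans _ _ (wsum (fun s => 2 `^ (p - 1) * (`|f s - k| `^ p + `|k| `^ p)))).
  apply: le_wsum => s; have := norm_powRD _ p (f s - k) k p1.
  by rewrite subrK.
rewrite wsumZ ?powR_ge0//; do ?by move=> s; rewrite addr_ge0 ?powR_ge0.
rewrite wsumD; do ?by move=> s; exact: powR_ge0.
have -> : 2 `^ p = 2 `^ (p - 1) * 2 :> R by rewrite mulrC mulr_powRB1//; lra.
rewrite EFinM -muleA lee_pmul2l ?lte_fin ?powR_gt0//.
rewrite mule_natl mule2n leeD2l// wsum_cst ?powR_ge0//.
exact: mean_le_lp.
Qed.

(* Clarkson's inequality for [f - k] and [k]; the extra term [|f - 2 k|^p] is
   absorbed by [mean_le_lp] at [2 k]. *)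
Lemma wsum_lp_le_shift2 p f k : 1 <= p <= 2 -> weight mu [set: V] \is a fin_num ->
  wsum (fun s => `|f s| `^ p) \is a fin_num -> weighted_sum mu f = 0%E ->
  (wsum (fun s => (`|f s| `^ p)%R) <= 2%:E * wsum (fun s => (`|f s - k| `^ p)%R))%E.
Proof.
move=> /andP[p1 p2] mufin ffin f0.
have Gfin := wsum_shift_fin p f k p1 mufin ffin.
have Hfin := wsum_shift_fin p f (2 * k) p1 mufin ffin.
have : (wsum (fun s => (`|f s| `^ p + `|f s - 2 * k| `^ p)%R) <=
    wsum (fun s => (2 * (`|f s - k| `^ p + `|k| `^ p))%R))%E.
  apply: le_wsum => s; have := @clarkson_le2 _ p (f s - k) k.
  rewrite p1 p2 subrK => /(_ isT).
  by have -> : f s - k - k = f s - 2 * k by ring.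
have := mean_le_lp p f (2 * k) p1 f0.
rewrite wsumZ//; do ?by move=> s; rewrite addr_ge0 ?powR_ge0.
rewrite !wsumD; do ?by move=> s; exact: powR_ge0.
rewrite wsum_cst ?powR_ge0// normrM powRM// ger0_norm//.
have : (0 <= weight mu [set: V])%E by apply: esum_ge0 => s _; rewrite lee_fin ltW.
move: mufin ffin Gfin Hfin.
case: (weight _ _) => [m| |]//; case: (wsum _) => [F| |]//.
case: (wsum _) => [G| |]//; case: (wsum _) => [H| |]// _ _ _ _.
rewrite -!EFinM -!EFinD !lee_fin.
(* Clarkson leaves 2 |k|^p mu(V), while the bound at 2 k supplies 2^p |k|^p mu(V), and 2 <= 2^p. *)
have : 0 <= (2 `^ p - 2) * `|k| `^ p.
  rewrite mulr_ge0 ?powR_ge0// subr_ge0.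
  by apply: le1r_powR; rewrite ?ler1n.
move=> kp m0; have := mulr_ge0 kp m0; lra.
Qed.

End WeightedSums.
Arguments wsum {R V} mu h.

(** * Gradients and tree paths to the root *)

Lemma card_le1_eq (T : Type) (A : set T) (x y : T) :
  (A #<= `I_1)%card -> A x -> A y -> x = y.
Proof.
move=> /card_leP[g] Ax Ay.
have g0 u : val (g u) = 0%N.
  by have := set_valP (g u); rewrite /= ltnS leqn0 => /eqP.
have guv (u v : A) : u = v.
  by apply: (@inj _ _ _ g); rewrite ?inE//; apply: val_inj; rewrite !g0.
by have /(congr1 val) := guv (exist _ x (mem_set Ax)) (exist _ y (mem_set Ay)).
Qed.

Section Graph.
Variables (R : realType) (V : countType) (e eT : rel V) (a : V) (M : nat).
Hypothesis deg_le : degree_le e M.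
Hypothesis eT_e : subrel eT e.
Hypothesis e_sym : symmetric e.
Hypothesis eT_connected : graph_connected eT.
Implicit Types (f h : V -> R) (s t : V).

Lemma gradient_ge0 f t : 0 <= gradient e f t.
Proof. by apply: fsumr_ge0 => s _. Qed.

Lemma le_gradient f s t : e s t -> `|f s - f t| <= gradient e f t.
Proof.
(* The degree bound makes the neighbor set finite, so the term at s can be split off. *)
move=> est; rewrite /gradient (fsbigD1 s)//; last first.
  by apply/finite_set_leP; exists M; exact: deg_le.
by rewrite lerDl; apply: fsumr_ge0.
Qed.

Lemma simple_path s : exists p : seq V, [/\ path eT s p, uniq (s :: p) & last s p = a].
Proof.
have [p pp <-] := eT_connected s a.
by case: (shortenP pp) => q pq uq _; exists q.
Qed.

(** Each edge is charged to its starting vertex. The last vertex starts no edge; its nonnegative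
    term is added so that the sum runs over the whole path. *)
Lemma path_telescope f h s (p : seq V) : (forall t, 0 <= h t) ->
  (forall x y, eT x y -> f x - f y <= h x) -> path eT s p ->
  f s <= f (last s p) + \sum_(t <- s :: p) h t.
Proof.
move=> h0 fh; elim: p s => [|y p IHp] s /=.
  by move=> _; rewrite big_seq1 lerDl.
move=> /andP[sy /IHp]; rewrite [in X in _ -> X]big_cons.
by have := fh _ _ sy; lra.
Qed.

Lemma le_esum_ancestors f h s : f a = 0 -> (forall t, 0 <= h t) ->
  (forall x y, eT x y -> f x - f y <= h x) ->
  ((f s)%:E <= \esum_(t in [set t | tree_ge eT a s t]) (h t)%:E)%E.
Proof.
move=> fa0 h0 fh; have [p [pp up lp]] := simple_path s.
(* Every vertex of the simple path to the root is an ancestor of s, so the path is a finite part of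
   the index set; having no repetition, it gives the same sum as a list and as a set. *)
apply: esum_ge; exists [set` s :: p].
  split; first exact: finite_seq.
  by move=> t /= tp; exists p.
rewrite fsumEFin; last exact: finite_seq.
rewrite lee_fin -fsbig_seq//.
by have := path_telescope f h s p h0 fh pp; rewrite lp fa0 add0r.
Qed.

Lemma dist_root_le_gradient f s : M = 1%N -> `|f s - f a| <= gradient e f s.
Proof.
move=> M1; have [[|y [|z p]] [/= pp up lp]] := simple_path s.
- by rewrite lp subrr normr0 gradient_ge0.
- rewrite -lp distrC; apply: le_gradient; rewrite e_sym; apply: eT_e.
  by move: pp; rewrite andbT.
(* With two or more edges, y would have the neighbors s and z, which degree 1 forces to coincide,
   against simplicity of the path. *)
- move: pp => /and3P[sy yz _].
  have := @card_le1_eq _ (neighbors e y) s z.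
  rewrite -M1 => /(_ (deg_le y) (eT_e _ _ sy)).
  rewrite /neighbors /= e_sym => /(_ (eT_e _ _ yz)) sz.
  by move: up; rewrite sz !inE eqxx orbT.
Qed.

(** * The Hardy inequality on the tree *)

Section Hardy.
Variables (mu : V -> R) (c : R).
Hypothesis mu_gt0 : forall t, 0 < mu t.
Hypothesis c_gt0 : 0 < c.
Hypothesis shadow_le :
  forall t : V, (weight mu (shadow eT a t) <= (c * mu t)%:E)%E.

Lemma shadow_root : shadow eT a a = [set: V].
Proof.
apply/seteqP; split=> // s _; have [p [pp up lp]] := simple_path s.
by exists p; split=> //; rewrite -lp mem_last.
Qed.

Lemma weight_fin : weight mu [set: V] \is a fin_num.
Proof.
rewrite ge0_fin_numE; last by apply: esum_ge0 => s _; rewrite lee_fin ltW.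
by rewrite -shadow_root; apply: le_lt_trans (shadow_le a) _; rewrite ltry.
Qed.

Lemma shadow_constant_ge1 : 1 <= c.
Proof.
rewrite -(ler_pM2r (mu_gt0 a)) mul1r -lee_fin.
apply: le_trans (shadow_le a); apply: esum_ge; exists [set a].
  split; first exact: finite_set1.
  by move=> _ ->; exists [::]; rewrite /= inE eqxx.
by rewrite fsbig_set1.
Qed.

(** Bound each f s by the sum of h over the ancestors of s and exchange the sums: h t is then
    counted with weight mu(S_t) <= c mu(t). *)
Lemma wsum_le_telescope f h : f a = 0 -> (forall t, 0 <= h t) ->
  (forall x y, eT x y -> f x - f y <= h x) ->
  (wsum mu f <= c%:E * wsum mu h)%E.
Proof.
move=> fa0 h0 fh.
apply: (@le_trans _ _ (\esum_(s in [set: V])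
    \esum_(t in [set t | tree_ge eT a s t]) ((mu s)%:E * (h t)%:E)%E)).
  apply: le_esum => s _; rewrite ge0_esumZl ?(ltW (mu_gt0 _))//.
  rewrite mulrC EFinM lee_pmul2l ?lte_fin//.
  exact: le_esum_ancestors.
rewrite esum_swap; last by move=> s t; rewrite lee_fin mulr_ge0 ?(ltW (mu_gt0 _)).
rewrite -(wsumZ _ _ mu mu_gt0) ?(ltW c_gt0)//.
apply: le_esum => t _.
under eq_esum do rewrite muleC.
rewrite ge0_esumZl//; last by move=> s; rewrite lee_fin ltW.
rewrite (mulrC c) -mulrA EFinM lee_wpmul2l ?lee_fin//.
exact: shadow_le.
Qed.

Lemma hardy p f : 1 <= p ->
  wsum mu (fun s => `|f s - f a| `^ p) \is a fin_num ->
  (wsum mu (fun s => (`|f s - f a| `^ p)%R) <=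
    ((c * p) `^ p)%:E * wsum mu (fun s => (gradient e f s `^ p)%R))%E.
Proof.
move=> p1 Gfin; have p0 : 0 < p by lra.
pose g s := f s - f a.
pose h s := p * `|g s| `^ (p - 1) * gradient e f s.
have h0 s : 0 <= h s by rewrite !mulr_ge0 ?powR_ge0 ?gradient_ge0// ltW.
have cp0 : 0 <= c * p by apply: mulr_ge0; exact: ltW.
have telescope := wsum_le_telescope (fun s => `|g s| `^ p) h.
have {telescope} Gh : (wsum mu (fun s => (`|g s| `^ p)%R) <= c%:E * wsum mu h)%E.
  apply: telescope => //.
    by rewrite /g subrr normr0 powR0 ?gt_eqF.
  move=> x y xy.
  (* The tangent is taken at |g x|, the endpoint where [h] is evaluated. *)
  have := powR_tangent _ p `|g y| `|g x| p1 (normr_ge0 _) (normr_ge0 _).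
  have : p * `|g x| `^ (p - 1) * (`|g x| - `|g y|) <= h x.
    apply: ler_wpM2l; first by rewrite mulr_ge0 ?powR_ge0 ?ltW.
    apply: le_trans (lerB_dist _ _) _.
    have -> : g x - g y = f x - f y by rewrite /g; ring.
    by rewrite distrC; apply: le_gradient; rewrite e_sym; exact: eT_e.
  lra.
(* Young's inequality is the tangent inequality at |g| evaluated at c p |grad f|: it reads p c h <=
   (p-1) |g|^p + (c p |grad f|)^p. *)
have young : (p%:E * (c%:E * wsum mu h) <=
    (p - 1)%:E * wsum mu (fun s => (`|g s| `^ p)%R) +
    ((c * p) `^ p)%:E * wsum mu (fun s => (gradient e f s `^ p)%R))%E.
  have p10 : 0 <= p - 1 by lra.
  have ch0 s : 0 <= c * h s := mulr_ge0 (ltW c_gt0) (h0 s).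
  have gp0 s : 0 <= gradient e f s `^ p := powR_ge0 _ _.
  have gp0' s : 0 <= `|g s| `^ p := powR_ge0 _ _.
  rewrite -!wsumZ ?powR_ge0 ?(ltW p0) ?(ltW c_gt0)//.
  rewrite -wsumD//; do ?by move=> s; rewrite mulr_ge0 ?powR_ge0.
  apply: le_wsum => // s.
  rewrite -powRM ?gradient_ge0//.
  have := powR_tangent _ p (c * p * gradient e f s) `|g s| p1
    (mulr_ge0 cp0 (gradient_ge0 _ _)) (normr_ge0 _).
  rewrite /h -(mulr_powRB1 (normr_ge0 (g s)) p0); lra.
have Gh' : (p%:E * wsum mu (fun s => (`|g s| `^ p)%R) <= p%:E * (c%:E * wsum mu h))%E.
  by rewrite lee_pmul2l ?lte_fin.
(* This is p G <= (p-1) G + (c p)^p D; since G is finite, (p-1) G can be subtracted. *)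
have := le_trans Gh' young.
move: Gfin; rewrite -/(wsum mu (fun s => `|g s| `^ p)).
case: (wsum mu (fun s => `|g s| `^ p)) => [G| |]// _.
set D := (_%:E * wsum _ (fun s => (gradient e f s `^ p)%R))%E.
have : (0 <= D)%E.
  apply: mule_ge0; first by rewrite lee_fin powR_ge0.
  by apply: wsum_ge0 => // s; exact: powR_ge0.
case: D => [D| |]// _; last by move=> _; rewrite leey.
rewrite -!EFinM -EFinD !lee_fin; lra.
Qed.

End Hardy.
End Graph.

(** * From sums of powers to norms, and the constant *)

Lemma lpnorm_wsum_le (R : realType) (V : countType) (mu : V -> R) (p K : R)
    (f g : V -> R) :
  (forall t, 0 < mu t) -> 1 <= p -> 0 <= K -> (forall s, 0 <= g s) ->
  (wsum mu (fun s => (`|f s| `^ p)%R) <=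
     (K `^ p)%:E * wsum mu (fun s => (g s `^ p)%R))%E ->
  (lpnorm mu p f <= K%:E * lpnorm mu p g)%E.
Proof.
move=> mu0 p1 K0 g0 fg; have p0 : 0 < p by lra.
have wsum0 h : (0 <= wsum mu (fun s => (h s `^ p)%R))%E.
  by apply: wsum_ge0 => // s; exact: powR_ge0.
rewrite /lpnorm -/(wsum mu (fun s => `|f s| `^ p)).
rewrite -/(wsum mu (fun s => `|g s| `^ p)).
have -> : (fun s => `|g s| `^ p) = (fun s => g s `^ p).
  by apply/funext => s; rewrite ger0_norm.
have -> : K%:E = ((K `^ p)%:E `^ p^-1)%E.
  by rewrite poweR_EFin -powRrM divff ?gt_eqF// powRr1.
rewrite -poweRM ?lee_fin ?powR_ge0//.
apply: gt0_ler_poweR => //; rewrite ?invr_ge0 ?(ltW p0)//.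
- by rewrite in_itv /= wsum0 leey.
- by rewrite in_itv /= leey andbT mule_ge0 ?lee_fin ?powR_ge0.
Qed.

Theorem theorem4p3 (R : realType) (V : countType) (e : rel V) (mu : V -> R)
    (M : nat) (eT : rel V) (a : V) (c p : R)
    (e_sym : symmetric e) (e_connected : graph_connected e)
    (mu_gt0 : forall t : V, 0 < mu t)
    (M_ge1 : (1 <= M)%N) (deg_le : degree_le e M)
    (tree : spanning_tree e eT) (c_gt0 : 0 < c)
    (shadow_le : forall t : V, (weight mu (shadow eT a t) <= (c * mu t)%:E)%E)
    (p_ge1 : 1 <= p) :
  exists CP : R,
    [/\ 0 < CP,
        CP <= 2 * c * (M%:R * p) `^ (1 - p^-1) &
        forall f : V -> R, in_lp mu p f -> weighted_sum mu f = 0%E ->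
          (lpnorm mu p f <= CP%:E * lpnorm mu p (gradient e f))%E].
Proof.
have [_ eT_e eT_connected _] := tree.
have p0 : 0 < p by lra.
have M1 : 1 <= M%:R :> R by rewrite ler1n.
have Mp1 : 1 <= M%:R * p by rewrite (le_trans p_ge1)// ler_peMl ?(ltW p0).
have Mp0 : 0 < M%:R * p by lra.
set CP := 2 * c * _.
have CP0 : 0 < CP by rewrite !mulr_gt0// powR_gt0.
exists CP; split=> // f f_lp f_mean.
apply: lpnorm_wsum_le => //; first exact: ltW.
  by move=> s; exact: gradient_ge0.
have mu_fin : weight mu [set: V] \is a fin_num by exact: weight_fin shadow_le.
have F_fin : wsum mu (fun s => `|f s| `^ p) \is a fin_num.
  rewrite ge0_fin_numE; last by apply: wsum_ge0 => // s; exact: powR_ge0.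
  by apply: lty_poweRy f_lp; rewrite invr_eq0 gt_eqF.
have G_fin := wsum_shift_fin _ _ mu mu_gt0 p f (f a) p_ge1 mu_fin F_fin.
(* The exponent is p (1 - 1/p) = p - 1. *)
have CPpE : CP `^ p = 2 `^ p * (c `^ p * (M%:R * p) `^ (p - 1)).
  rewrite /CP; move: (M%:R * p) => X.
  rewrite !powRM ?mulr_ge0 ?powR_ge0 ?(ltW c_gt0)//.
  rewrite -mulrA -powRrM; congr (_ * (_ * _ `^ _)).
  by rewrite mulrBl mul1r mulVf ?gt_eqF.
have hardy_f := hardy _ _ _ _ _ _ deg_le eT_e e_sym eT_connected _ _ mu_gt0 c_gt0
  shadow_le _ _ p_ge1 G_fin.
have G_le := wsum_lp_le_shift _ _ mu mu_gt0 p f (f a) p_ge1 f_mean.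
have D0 : (0 <= wsum mu (fun s => (gradient e f s `^ p)%R))%E.
  by apply: wsum_ge0 => // s; exact: powR_ge0.
have cpE : (c * p) `^ p = c `^ p * (p * p `^ (p - 1)).
  by rewrite powRM ?(ltW c_gt0) ?(ltW p0)// mulr_powRB1 ?(ltW p0).
have [M_eq1|M_neq1] := eqVneq M 1%N.
  (* For M = 1, [hardy] would give p^p where only p^(p-1) is available. The pointwise bound by the
     gradient avoids this loss, and c^p (M p)^(p-1) >= 1. *)
  have c1 := shadow_constant_ge1 _ _ _ _ _ _ mu_gt0 shadow_le.
  apply: le_trans G_le _; rewrite CPpE EFinM -muleA.
  rewrite lee_pmul2l ?lte_fin ?powR_gt0//.
  apply: (@le_trans _ _ (wsum mu (fun s => (gradient e f s `^ p)%R))).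
    apply: le_wsum => // s; apply: ge0_ler_powR; rewrite ?nnegrE ?(ltW p0)//.
      exact: gradient_ge0.
    exact: (dist_root_le_gradient _ _ _ eT).
  rewrite -[leLHS]mul1e; apply: lee_wpmul2r => //; rewrite lee_fin.
  have one_le (x q : R) : 1 <= x -> 0 <= q -> 1 <= x `^ q.
    by move=> x1 q0; rewrite -(powRr0 x); exact: ler_powR.
  rewrite -[leLHS]mulr1; apply: ler_pM => //; apply: one_le => //; lra.
have M2 : 2 <= M%:R :> R by rewrite ler_nat ltn_neqAle eq_sym M_neq1.
have Mp : (2 * p) `^ (p - 1) <= (M%:R * p) `^ (p - 1).
  apply: ge0_ler_powR; rewrite ?nnegrE ?subr_ge0 ?(ltW Mp0)//.
    by rewrite mulr_ge0 ?(ltW p0).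
  by rewrite ler_pM2r.
(* Combined with [hardy], the target is K (c p)^p <= 2^p c^p (2 p)^(p-1); cancelling c^p p^(p-1)
   leaves the condition on [K]. *)
suff [K FK KCP] : exists2 K : R, (wsum mu (fun s => (`|f s| `^ p)%R) <=
      K%:E * wsum mu (fun s => (`|f s - f a| `^ p)%R))%E &
    0 <= K /\ K * p <= 2 `^ p * 2 `^ (p - 1).
  case: KCP => K0 KCP; apply: le_trans FK _.
  apply: le_trans (lee_wpmul2l _ hardy_f) _; first by rewrite lee_fin.
  rewrite muleA -EFinM; apply: lee_wpmul2r => //; rewrite lee_fin CPpE cpE.
  rewrite mulrCA [leRHS]mulrCA ler_pM2l ?powR_gt0//.
  apply: le_trans (ler_wpM2l (powR_ge0 _ _) Mp).
  rewrite powRM ?(ltW p0)// mulrA [leRHS]mulrA.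
  by rewrite ler_pM2r ?powR_gt0.
have [p2|p2] := leP 2 p.
  exists (2 `^ p) => //; split; first exact: powR_ge0.
  by rewrite ler_pM2l ?powR_gt0// le_powR2.
(* The factor 2^p would require p <= 2^(p-1), which fails for 1 < p < 2. With K = 2 the condition
   becomes p <= 4^(p-1). *)
exists 2; first by apply: wsum_lp_le_shift2; rewrite ?p_ge1 ?(ltW p2).
split=> //; rewrite -(@mulr_powRB1 _ 2 p)// -mulrA ler_pM2l//.
have -> : 2 `^ (p - 1) * 2 `^ (p - 1) = 4 `^ (p - 1) :> R.
  by rewrite -powRM//; congr powR; ring.
exact: le_powR4.
Qed.
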